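(* Let $M\in\mathbb{R}^{m\times m}$ be nonsymmetric and positive definite, let $A\in\mathbb{R}^{m\times n}$ have full column rank, and let $b\in\mathbb{R}^n$, $b\neq0$. Suppose that the nonsymmetric generalized Golub-Kahan process started from $b$ (described in the context) runs for $n$ steps, and let $Q=Q_n$, $V=V_n$, $B=B_n$, $L=L_n$ be the resulting matrices and $\beta_1=\|b\|_2$. Then the solution $(u,p)\in\mathbb{R}^m\times\mathbb{R}^n$ of $$\begin{bmatrix} M & A\\ A^T & 0\end{bmatrix}\begin{bmatrix}u\\ p\end{bmatrix}=\begin{bmatrix}0\\ b\end{bmatrix}$$ is given by $$u=Vz,\quad z=\beta_1L^{-T}B^{-T}e_1,\qquad p=Qy,\quad y=-B^{-1}z,$$ where $e_1$ is the first standard basis vector of $\mathbb{R}^n$.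
   Context: Positive definite means $x^TMx>0$ for all nonzero $x\in\mathbb{R}^m$ (no symmetry required). Write $\|x\|_M=\sqrt{x^TMx}$ and $\|\cdot\|_2$ for the Euclidean norm. Exact arithmetic is assumed. $X^{-T}$ denotes $(X^{-1})^T$. Nonsymmetric generalized Golub-Kahan process started from $b$: set $\beta_1=\|b\|_2$, $q_1=b/\beta_1$, $w_1=M^{-1}Aq_1$, $\alpha_1=\|w_1\|_M$, $v_1=w_1/\alpha_1$. For $j=2,3,\dots$: with $Q_{j-1}=[q_1,\dots,q_{j-1}]$, set $h_j=Q_{j-1}^TA^Tv_{j-1}=(\theta_{1,j},\dots,\theta_{j-1,j})^T$, $g_j=A^Tv_{j-1}-Q_{j-1}h_j$, $\beta_j=\|g_j\|_2$; if $\beta_j=0$ the process stops; otherwise $q_j=g_j/\beta_j$, $w_j=M^{-1}(Aq_j-\beta_jMv_{j-1})$, $\alpha_j=\|w_j\|_M$, $v_j=w_j/\alpha_j$. ''The process runs for $k$ steps'' means that $\beta_1,\dots,\beta_k$ are all nonzero, so that $q_1,\dots,q_k$ and $v_1,\dots,v_k$ are defined. Matrices: $Q_k=[q_1,\dots,q_k]\in\mathbb{R}^{n\times k}$, $V_k=[v_1,\dots,v_k]\in\mathbb{R}^{m\times k}$, $L_k=V_k^TMV_k\in\mathbb{R}^{k\times k}$. $B_k\in\mathbb{R}^{k\times k}$ is the upper bidiagonal matrix with diagonal $\alpha_1,\dots,\alpha_k$ and superdiagonal $\beta_2,\dots,\beta_k$ (that is, $(B_k)_{j-1,j}=\beta_j$).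 The matrices $B_k$ and $L_k$ are invertible. *)

(* Defs.v *)
From HB Require Import structures.
From mathcomp Require Import all_boot all_order all_algebra.
From mathcomp Require Import reals.

Set Implicit Arguments.
Unset Strict Implicit.
Unset Printing Implicit Defensive.

Import Order.TTheory GRing.Theory Num.Theory.
Local Open Scope ring_scope.

Section GolubKahan.

Variable R : rcfType.

(* Symmetry of M is not part of the definition. *)
Definition posdefmx (m : nat) (M : 'M[R]_m) : Prop :=
  forall x : 'cV[R]_m, x != 0 -> 0 < (x^T *m M *m x) 0 0.

Definition norm2 (n : nat) (x : 'cV[R]_n) : R :=
  Num.sqrt (\sum_i x i 0 ^+ 2).

Definition normM (m : nat) (M : 'M[R]_m) (x : 'cV[R]_m) : R :=
  Num.sqrt ((x^T *m M *m x) 0 0).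

Definition colsmx (n k : nat) (x : nat -> 'cV[R]_n) : 'M[R]_(n, k) :=
  \matrix_(i < n, j < k) x j i 0.

(* The state after step j: the list q_1, ..., q_j, and v_j, alpha_j, beta_j. *)
Record gk_state (m n : nat) := GKState {
  gks_qs : seq 'cV[R]_n;
  gks_v : 'cV[R]_m;
  gks_alpha : R;
  gks_beta : R
}.

Section Process.

Variables (m n : nat) (M : 'M[R]_m) (A : 'M[R]_(m, n)) (b : 'cV[R]_n).

Definition gk_init : gk_state m n :=
  let beta := norm2 b in
  let q := beta^-1 *: b in
  let w := invmx M *m (A *m q) in
  let alpha := normM M w in
  GKState [:: q] (alpha^-1 *: w) alpha beta.

(* A vanishing beta is not tested here: the step is then continued with q = 0,
   and it is gk_runs that excludes this case. *)
Definition gk_next (s : gk_state m n) : gk_state m n :=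
  let v := gks_v s in
  let Q := colsmx (size (gks_qs s)) (nth 0 (gks_qs s)) in
  let h := Q^T *m (A^T *m v) in
  let g := A^T *m v - Q *m h in
  let beta := norm2 g in
  let q := beta^-1 *: g in
  let w := invmx M *m (A *m q - beta *: (M *m v)) in
  let alpha := normM M w in
  GKState (rcons (gks_qs s) q) (alpha^-1 *: w) alpha beta.

(* Steps are numbered from 1; the value at j = 0 is meaningless. *)
Definition gk_step (j : nat) : gk_state m n := iter j.-1 gk_next gk_init.

Definition gk_q (j : nat) : 'cV[R]_n := last 0 (gks_qs (gk_step j)).
Definition gk_v (j : nat) : 'cV[R]_m := gks_v (gk_step j).
Definition gk_alpha (j : nat) : R := gks_alpha (gk_step j).
Definition gk_beta (j : nat) : R := gks_beta (gk_step j).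

Definition gk_runs (k : nat) : Prop :=
  forall j : nat, (1 <= j <= k)%N -> gk_beta j != 0.

(* Matrix indices start at 0, so column j holds the vector of step j + 1. *)
Definition gk_Q (k : nat) : 'M[R]_(n, k) := colsmx k (fun j => gk_q j.+1).
Definition gk_V (k : nat) : 'M[R]_(m, k) := colsmx k (fun j => gk_v j.+1).

Definition gk_L (k : nat) : 'M[R]_k := (gk_V k)^T *m M *m gk_V k.

Definition gk_B (k : nat) : 'M[R]_k :=
  \matrix_(i < k, j < k)
    if i == j :> nat then gk_alpha j.+1
    else if i.+1 == j :> nat then gk_beta j.+1
    else 0.

End Process.

(* First standard basis vector; stated for every n, as 'I_n has no 0 when n = 0. *)
Definition e1 (n : nat) : 'cV[R]_n := \col_(i < n) (i == 0 :> nat)%:R.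

End GolubKahan.

Arguments e1 {R n}.

(* Main.v *)
Require Import Defs.
From HB Require Import structures.
From mathcomp Require Import all_boot all_order all_algebra.
From mathcomp Require Import reals.

Set Implicit Arguments.
Unset Strict Implicit.
Unset Printing Implicit Defensive.

Import Order.TTheory GRing.Theory Num.Theory.
Local Open Scope ring_scope.

(** The formula rests on three properties of the process: the vectors q_j are
    orthonormal (lemma [gk_q_orthonormal]), the coefficients are collected in
    the factorization A Q = M V B (lemma [gk_factorization]), and b = beta_1 Q e_1.

    After n steps Q is a square orthogonal matrix. Injectivity of A and of Q then
    makes A Q = M V B injective, so B is invertible and V is injective, and hence
    L = V^T M V is positive definite, so invertible. Transposing the
    factorization gives Q^T A^T V = B^T V^T M^T V = B^T L^T, that is
    A^T V = Q B^T L^T. Substituting u = V z and p = - Q B^-1 z, the first block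
    row of the system is M V z - M V B B^-1 z = 0, and the second one is
    Q B^T L^T z = beta_1 Q e_1 = b. The system has no other solution: if the
    right-hand side is 0, then u^T M u = - (A^T u)^T p = 0, hence u = 0, then
    A p = 0 and p = 0. *)

(** * Positive definite and injective matrices *)

Section LinearAlgebra.

Variable R : rcfType.

Lemma posdefmx_inj m (M : 'M[R]_m) (x : 'cV_m) :
  posdefmx M -> (x^T *m M *m x) 0 0 = 0 -> x = 0.
Proof. by move=> Mpos xMx; apply/eqP/negP=> /negP/Mpos; rewrite xMx ltxx. Qed.

Lemma unitmx_inj m (M : 'M[R]_m) :
  (forall x : 'cV_m, M *m x = 0 -> x = 0) -> M \in unitmx.
Proof.
move=> Minj; rewrite -unitmx_tr -row_free_unit; apply: inj_row_free => v vM0.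
by rewrite -[v]trmxK (Minj v^T) ?trmx0 // -[M]trmxK -trmx_mul vM0 trmx0.
Qed.

Lemma posdefmx_unit m (M : 'M[R]_m) : posdefmx M -> M \in unitmx.
Proof.
move=> Mpos; apply: unitmx_inj => x Mx0; apply: (posdefmx_inj Mpos).
by rewrite -mulmxA Mx0 mulmx0 mxE.
Qed.

Lemma mulmx_full_col_inj m n (A : 'M[R]_(m, n)) (x : 'cV_n) :
  \rank A = n -> A *m x = 0 -> x = 0.
Proof.
move=> rA Ax0; apply/trmx_inj/eqP; rewrite trmx0.
have freeAT : row_free A^T by rewrite /row_free mxrank_tr rA.
by rewrite -(mulmx_free_eq0 _ freeAT) -trmx_mul Ax0 trmx0.
Qed.

(** * Saddle-point systems *)

Section SaddlePoint.

Variables (m n : nat) (M : 'M[R]_m) (A : 'M[R]_(m, n)).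
Hypotheses (M_posdef : posdefmx M) (A_fullrank : \rank A = n).

Lemma saddle_point_inj (u : 'cV_m) (p : 'cV_n) :
  M *m u + A *m p = 0 -> A^T *m u = 0 -> u = 0 /\ p = 0.
Proof.
move=> MuAp ATu.
have MuE : M *m u = - (A *m p) by apply/eqP; rewrite -addr_eq0 MuAp.
have u0 : u = 0.
  apply: (posdefmx_inj M_posdef); rewrite -mulmxA MuE.
  (* u^T M u = - u^T A p = - (A^T u)^T p = 0 *)
  by rewrite mulmxN mulmxA -[A]trmxK -trmx_mul ATu trmx0 mul0mx oppr0 mxE.
split=> //; apply: (mulmx_full_col_inj A_fullrank).
by rewrite -MuAp u0 mulmx0 add0r.
Qed.

Variables (Q : 'M[R]_n) (V : 'M[R]_(m, n)) (B : 'M[R]_n).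
Hypotheses (Q_orth : Q^T *m Q = 1%:M) (AQ : A *m Q = M *m V *m B).

Let L := V^T *m M *m V.

Lemma factor_AQ_inj (x : 'cV_n) : A *m Q *m x = 0 -> x = 0.
Proof.
rewrite -mulmxA => /(mulmx_full_col_inj A_fullrank) Qx0.
by rewrite -[x]mul1mx -Q_orth -mulmxA Qx0 mulmx0.
Qed.

Lemma factor_B_unit : B \in unitmx.
Proof.
by apply: unitmx_inj => x Bx0; apply: factor_AQ_inj; rewrite AQ -mulmxA Bx0 mulmx0.
Qed.

(** As B is surjective, V x = 0 with x = B y gives A Q y = M V B y = 0, so that V
    inherits injectivity from A Q. *)
Lemma factor_V_inj (x : 'cV_n) : V *m x = 0 -> x = 0.
Proof.
move=> Vx0; rewrite -[x](mulKVmx factor_B_unit).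
rewrite [invmx B *m x]factor_AQ_inj ?mulmx0 //.
by rewrite AQ -mulmxA (mulKVmx factor_B_unit) -mulmxA Vx0 mulmx0.
Qed.

Lemma factor_L_unit : L \in unitmx.
Proof.
apply: posdefmx_unit => x x_neq0; rewrite /L !mulmxA -trmx_mul -mulmxA.
by apply: M_posdef; apply: contraNneq x_neq0 => /factor_V_inj ->.
Qed.

Lemma factor_trAV : A^T *m V = Q *m (B^T *m L^T).
Proof.
rewrite /L -trmx_mul -!mulmxA [M *m _]mulmxA -AQ !trmx_mul trmxK.
(* a square matrix with orthonormal columns also satisfies Q Q^T = 1 *)
by rewrite !mulmxA (mulmx1C Q_orth) mul1mx.
Qed.

(** Existence is a substitution using [AQ] in the first block row and
    [factor_trAV] in the second; uniqueness is [saddle_point_inj] applied to the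
    difference of two solutions. *)
Lemma saddle_point_factor_sol (b c : 'cV_n) (u : 'cV_m) (p : 'cV_n) :
  b = Q *m c ->
  let z := (invmx L)^T *m (invmx B)^T *m c in
  block_mx M A A^T 0 *m col_mx u p = col_mx 0 b
    <-> u = V *m z /\ p = Q *m - (invmx B *m z).
Proof.
move=> bE z.
have uB := factor_B_unit; have uL := factor_L_unit.
have sol1 : M *m (V *m z) + A *m (Q *m - (invmx B *m z)) = 0.
  by rewrite !mulmxN [A *m _]mulmxA AQ -mulmxA mulKVmx // mulmxA subrr.
have sol2 : A^T *m (V *m z) = b.
  rewrite mulmxA factor_trAV bE -!mulmxA; congr (_ *m _).
  rewrite /z !trmx_inv -mulmxA mulKVmx ?unitmx_tr //.
  by rewrite mulKVmx ?unitmx_tr.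
rewrite mul_block_col mul0mx addr0; split=> [/eq_col_mx[sys1 sys2]|[-> ->]].
  have [] := @saddle_point_inj (u - V *m z) (p - Q *m - (invmx B *m z)).
  - by rewrite !mulmxBr addrACA sys1 -opprD sol1 subr0.
  - by rewrite mulmxBr sys2 sol2 subrr.
  by move=> /subr0_eq-> /subr0_eq->.
by rewrite sol1 sol2.
Qed.

End SaddlePoint.

(** * Columns and inner products *)

Definition dot n (x y : 'cV[R]_n) : R := (x^T *m y) 0 0.

Lemma norm2_sqr n (x : 'cV[R]_n) : norm2 x ^+ 2 = dot x x.
Proof.
rewrite /norm2 sqr_sqrtr; last by apply: sumr_ge0 => i _; exact: sqr_ge0.
by rewrite /dot mxE; apply: eq_bigr => i _; rewrite mxE expr2.
Qed.

Lemma dotC n (x y : 'cV[R]_n) : dot x y = dot y x.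
Proof. by rewrite /dot !mxE; apply: eq_bigr => i _; rewrite !mxE mulrC. Qed.

Lemma dotZr n (x y : 'cV[R]_n) a : dot x (a *: y) = a * dot x y.
Proof. by rewrite /dot -scalemxAr mxE. Qed.

Lemma dotBr n (x y z : 'cV[R]_n) : dot x (y - z) = dot x y - dot x z.
Proof. by rewrite /dot mulmxBr !mxE. Qed.

Lemma dot_sumr n k (x : 'cV[R]_n) (f : 'I_k -> 'cV[R]_n) :
  dot x (\sum_i f i) = \sum_i dot x (f i).
Proof. by rewrite /dot mulmx_sumr summxE. Qed.

Lemma colsmx_mul n k (f : nat -> 'cV[R]_n) (x : 'cV[R]_k) :
  colsmx k f *m x = \sum_(i < k) x i 0 *: f i.
Proof.
apply/colP=> r; rewrite mxE summxE; apply: eq_bigr => i _.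
by rewrite !mxE mulrC.
Qed.

Lemma col_mulmx m n k (A : 'M[R]_(m, n)) (C : 'M[R]_(n, k)) j :
  col j (A *m C) = A *m col j C.
Proof. by rewrite !colE mulmxA. Qed.

Lemma col_colsmx n k (f : nat -> 'cV[R]_n) (j : 'I_k) : col j (colsmx k f) = f j.
Proof. by apply/colP=> i; rewrite !mxE. Qed.

Lemma colsmx_tr_mul n k (f : nat -> 'cV[R]_n) (x : 'cV[R]_n) (i : 'I_k) :
  ((colsmx k f)^T *m x) i 0 = dot (f i) x.
Proof. by rewrite /dot !mxE; apply: eq_bigr => r _; rewrite !mxE. Qed.

Lemma scaled_unit n (x : 'cV[R]_n) :
  norm2 x != 0 -> dot ((norm2 x)^-1 *: x) ((norm2 x)^-1 *: x) = 1.
Proof.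
move=> nx; rewrite dotZr dotC dotZr -norm2_sqr mulrA -expr2 -exprMn.
by rewrite mulVf // expr1n.
Qed.

(** The degenerate case of norm 0 is harmless: it occurs for x = 0 only, where
    both sides vanish. *)
Lemma normM_scaleK m (M : 'M[R]_m) (x : 'cV_m) :
  posdefmx M -> normM M x *: ((normM M x)^-1 *: x) = x.
Proof.
move=> Mpos; have [->|x_neq0] := eqVneq x 0; first by rewrite !scaler0.
have nx : normM M x != 0 by rewrite gt_eqF // sqrtr_gt0 Mpos.
by rewrite scalerA divff // scale1r.
Qed.

(** * The recurrences of the process *)

Section Process.

Variables (m n : nat) (M : 'M[R]_m) (A : 'M[R]_(m, n)) (b : 'cV[R]_n).

Local Notation step := (gk_step M A b).
Local Notation q := (gk_q M A b).
Local Notation v := (gk_v M A b).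
Local Notation alpha := (gk_alpha M A b).
Local Notation beta := (gk_beta M A b).

Lemma gk_stepS j : step j.+2 = gk_next M A (step j.+1).
Proof. by []. Qed.

Lemma gk_qs j : gks_qs (step j.+1) = mkseq (fun i => q i.+1) j.+1.
Proof.
elim: j => [//|j IHj].
by rewrite mkseqS -IHj /gk_q gk_stepS /= last_rcons.
Qed.

(** The vector g of step j + 2, with the projection Q Q^T expanded along the
    columns of Q, so that no dimension depends on the length of a list. *)
Definition gk_residual j : 'cV[R]_n :=
  A^T *m v j.+1 - \sum_(i < j.+1) dot (q i.+1) (A^T *m v j.+1) *: q i.+1.

Lemma gk_residualE j (s := step j.+1)
    (Qs := colsmx (size (gks_qs s)) (nth 0 (gks_qs s))) :
  A^T *m gks_v s - Qs *m (Qs^T *m (A^T *m gks_v s)) = gk_residual j.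
Proof.
rewrite /gk_residual -/(v j.+1) -/s; congr (_ - _); rewrite colsmx_mul.
under eq_bigr => i _ do rewrite colsmx_tr_mul.
rewrite /s gk_qs size_mkseq; apply: eq_bigr => i _.
by rewrite nth_mkseq.
Qed.

Lemma gk_betaS j : beta j.+2 = norm2 (gk_residual j).
Proof. by rewrite -gk_residualE. Qed.

Lemma gk_qS j : q j.+2 = (beta j.+2)^-1 *: gk_residual j.
Proof. by rewrite /gk_q gk_stepS /= last_rcons -gk_residualE. Qed.

Lemma gk_q_unit j : beta j.+1 != 0 -> dot (q j.+1) (q j.+1) = 1.
Proof.
case: j => [|j]; first exact: scaled_unit.
by rewrite gk_qS gk_betaS; exact: scaled_unit.
Qed.

(** Each new vector is a Gram-Schmidt residual, orthogonal to the previous ones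
    as soon as these are orthonormal. *)
Lemma gk_q_orthonormal k : gk_runs M A b k ->
  forall i j : nat, (i < k)%N -> (j < k)%N -> dot (q i.+1) (q j.+1) = (i == j)%:R.
Proof.
elim: k => [//|k IHk] runs.
have {}IHk : forall i j : nat, (i < k)%N -> (j < k)%N ->
    dot (q i.+1) (q j.+1) = (i == j)%:R.
  by apply: IHk => j /andP[j_gt0 lejk]; apply: runs; rewrite j_gt0 leqW.
have new i : (i < k)%N -> dot (q i.+1) (q k.+1) = 0.
  case: k {runs} IHk => [//|k] IHk lt_ik.
  rewrite gk_qS dotZr dotBr dot_sumr (bigD1 (Ordinal lt_ik)) //=.
  rewrite dotZr IHk // eqxx mulr1 big1 ?addr0 ?subrr ?mulr0 // => l l_neq_i.
  rewrite -val_eqE /= in l_neq_i.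
  by rewrite dotZr IHk // eq_sym (negPf l_neq_i) mulr0.
move=> i j; rewrite !ltnS (leq_eqVlt i) (leq_eqVlt j).
case/predU1P=> [->|lt_ik]; case/predU1P=> [->|lt_jk].
- by rewrite eqxx gk_q_unit // runs /=.
- by rewrite dotC new // gtn_eqF.
- by rewrite new // ltn_eqF.
- exact: IHk.
Qed.

Lemma gk_Q_orthonormal k : gk_runs M A b k ->
  (gk_Q M A b k)^T *m gk_Q M A b k = 1%:M.
Proof.
move=> runs; apply/matrixP=> i j.
have := gk_q_orthonormal runs (ltn_ord i) (ltn_ord j).
by rewrite /dot !mxE => <-; apply: eq_bigr => l _; rewrite !mxE.
Qed.

Hypothesis M_posdef : posdefmx M.

Lemma gk_A_q1 : A *m q 1 = M *m (alpha 1 *: v 1).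
Proof. by rewrite [_ *: _]normM_scaleK // mulKVmx // posdefmx_unit. Qed.

Lemma gk_A_qS j :
  A *m q j.+2 = M *m (alpha j.+2 *: v j.+2 + beta j.+2 *: v j.+1).
Proof.
have -> : alpha j.+2 *: v j.+2
    = invmx M *m (A *m q j.+2 - beta j.+2 *: (M *m v j.+1)).
  by rewrite [LHS]normM_scaleK // /gk_q gk_stepS /= last_rcons.
by rewrite mulmxDr mulKVmx ?posdefmx_unit // -scalemxAr subrK.
Qed.

(** Column j reads A q_j = M (alpha_j v_j + beta_j v_(j-1)), which is the
    definition of w_j = alpha_j v_j. *)
Lemma gk_factorization k :
  A *m gk_Q M A b k = M *m gk_V M A b k *m gk_B M A b k.
Proof.
apply/trmx_inj/row_matrixP=> j; rewrite -!tr_col; congr (_^T).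
rewrite -mulmxA !col_mulmx col_colsmx colsmx_mul.
rewrite (bigD1 j) //= !mxE eqxx.
case: j => [[|j] lt_jk] /=.
  rewrite big1 ?addr0 ?gk_A_q1 // => i i_neq0.
  by rewrite !mxE /= ifN ?scale0r.
have lt_j'k := ltnW lt_jk.
rewrite (bigD1 (Ordinal lt_j'k)) /=; last by rewrite -val_eqE /= ltn_eqF.
rewrite !mxE /= ltn_eqF // eqxx big1 ?addr0 ?gk_A_qS // => i /andP[i_neq i_neq'].
by rewrite !mxE /= eqSS !ifN ?scale0r.
Qed.

End Process.

Lemma gk_b_eq m n (M : 'M[R]_m) (A : 'M[R]_(m, n)) (b : 'cV[R]_n) k :
  gk_runs M A b k.+1 -> b = gk_Q M A b k.+1 *m (norm2 b *: e1).
Proof.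
move=> runs; rewrite colsmx_mul big_ord_recl big1 ?addr0; last first.
  by move=> i _; rewrite !mxE mulr0 scale0r.
by rewrite !mxE mulr1 scalerA divff ?scale1r //; exact: (runs 1%N).
Qed.

End LinearAlgebra.

Theorem mainTheorem2 (R : realType) (m n : nat)
    (M : 'M[R]_m) (A : 'M[R]_(m, n)) (b : 'cV[R]_n)
    (M_posdef : posdefmx M) (A_fullrank : \rank A = n) (b_neq0 : b != 0)
    (runs : gk_runs M A b n) :
  let Q := gk_Q M A b n in
  let V := gk_V M A b n in
  let B := gk_B M A b n in
  let L := gk_L M A b n in
  let z := norm2 b *: ((invmx L)^T *m (invmx B)^T *m e1) in
  let y := - (invmx B *m z) in
  forall (u : 'cV[R]_m) (p : 'cV[R]_n),
    block_mx M A A^T 0 *m col_mx u p = col_mx 0 b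
    <-> u = V *m z /\ p = Q *m y.
Proof.
move=> Q V B L z y u p; rewrite /y /z scalemxAr.
apply: saddle_point_factor_sol => //.
- exact: gk_Q_orthonormal.
- exact: gk_factorization.
(* for n = 0 the vector b would be empty, hence 0 *)
rewrite {L z y V B u p}/Q; case: n A b {A_fullrank} b_neq0 runs => [|k] A b.
  by rewrite [b]flatmx0 eqxx.
by move=> _; exact: gk_b_eq.
Qed.
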